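(* A tree $t$ is a Union-Find tree if and only if $t\vdash^* s$ for some Union tree $s$.
   Context: A tree is $t=(V_t,\mathrm{root}_t,\mathrm{parent}_t)$ with $V_t$ a finite set of nodes, $\mathrm{root}_t\in V_t$, and $\mathrm{parent}_t:V_t\setminus\{\mathrm{root}_t\}\to V_t$ such that iterating $\mathrm{parent}_t$ from any node reaches the root. $x\preceq_t y$ means $x=\mathrm{parent}_t^k(y)$ for some $k\ge0$; $\mathrm{size}(t,x)=|\{y:x\preceq_t y\}|$, $\mathrm{size}(t)=\mathrm{size}(t,\mathrm{root}_t)$. For trees $t,s$ with disjoint node sets, $\textsc{merge}(t,s)$ is the tree on $V_t\cup V_s$ with root $\mathrm{root}_t$, in which $\mathrm{root}_s$ becomes a child of $\mathrm{root}_t$ and all other parents are as in $t$ and $s$. For a node $x$ of $t$, $\textsc{collapse}(t,x)$ is obtained by setting the parent of every non-root ancestor of $x$ (including $x$ itself if not the root) to $\mathrm{root}_t$, all other parents unchanged. Union trees: the least class of trees containing all one-node trees and containing $\textsc{merge}(t,s)$ whenever $t,s$ are in it with $\mathrm{size}(t)\ge\mathrm{size}(s)$. Union-Find trees: the least class containing all one-node trees, closed under $\textsc{merge}(t,s)$ for members with $\mathrm{size}(t)\ge\mathrm{size}(s)$, and closed under $\textsc{collapse}(t,x)$ for any member $t$ and node $x$. For distinct siblings $x\neq y$ in $t$, $\mathrm{push}(t,x,y)$ is the tree with the same nodes and root where the parent of $x$ becomes $y$, all other parents unchanged. $t\vdash t'$ means $t'=\mathrm{push}(t,x,y)$ for some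 such $x,y$; $\vdash^*$ is the reflexive-transitive closure of $\vdash$. *)

(* Defs.v *)
(* Mathematical Components, with finmap for finite sets and maps. *)
From Stdlib Require Export Relations.Relation_Operators.
From mathcomp Require Export all_boot finmap.
From mathcomp Require Import boolp.

Set Implicit Arguments.
Unset Strict Implicit.
Unset Printing Implicit Defensive.

Local Open Scope fset_scope.
Local Open Scope fmap_scope.

(* Raw tree data: is_tree below says when they form a tree. The parent function
   is a finite map, whose domain is to be the set of non-root nodes, so that
   two trees with the same nodes, root and parents are equal. *)
Record tree (K : choiceType) := Tree {
  nodes : {fset K};
  root : K;
  parent : {fmap K -> K}
}.

Section Trees.

Variable K : choiceType.
Implicit Types (t s : tree K) (x y z : K).

(* The k-th iterate of the parent function; None once the root is passed. *)
Definition iter_parent t (k : nat) (y : K) : option K :=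
  iter k (obind (fun z => (parent t).[? z])) (Some y).

Definition ancestor t x y : bool :=
  `[< exists k : nat, iter_parent t k y = Some x >].

Record is_tree t : Prop := IsTree {
  root_in_nodes : root t \in nodes t;
  parent_dom : domf (parent t) = nodes t `\ root t;
  parent_in_nodes :
    forall x y, (parent t).[? x] = Some y -> y \in nodes t;
  root_reached : forall x, x \in nodes t -> ancestor t (root t) x
}.

Definition size_at t x : nat := #|` [fset y in nodes t | ancestor t x y]|.

Definition tree_size t : nat := size_at t (root t).

Definition single x : tree K := Tree [fset x] x [fmap].

(* Only the case of disjoint node sets is meaningful. *)
Definition merge t s : tree K :=
  Tree (nodes t `|` nodes s) (root t)
       (parent t + parent s).[root s <- root t].

Definition collapse t x : tree K :=
  Tree (nodes t) (root t)
       [fmap z : domf (parent t) =>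
          if ancestor t (val z) x then root t else parent t z].

Inductive union_tree : tree K -> Prop :=
| union_single x : union_tree (single x)
| union_merge t s :
    union_tree t -> union_tree s -> [disjoint nodes t & nodes s]%fset ->
    tree_size s <= tree_size t -> union_tree (merge t s).

Inductive union_find_tree : tree K -> Prop :=
| union_find_single x : union_find_tree (single x)
| union_find_merge t s :
    union_find_tree t -> union_find_tree s ->
    [disjoint nodes t & nodes s]%fset ->
    tree_size s <= tree_size t -> union_find_tree (merge t s)
| union_find_collapse t x :
    union_find_tree t -> x \in nodes t -> union_find_tree (collapse t x).

Definition siblings t x y : Prop :=
  exists p, (parent t).[? x] = Some p /\ (parent t).[? y] = Some p.

Definition push t x y : tree K :=
  Tree (nodes t) (root t) (parent t).[x <- y].

Definition push_step t t' : Prop :=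
  exists x y, [/\ x <> y, siblings t x y & t' = push t x y].

Definition push_steps : tree K -> tree K -> Prop :=
  clos_refl_trans (tree K) push_step.

Lemma ancestorP t x y :
  reflect (exists k : nat, iter_parent t k y = Some x) (ancestor t x y).
Proof. exact: asboolP. Qed.

Lemma iter_parentS t k x :
  iter_parent t k.+1 x =
  if (parent t).[? x] is Some y then iter_parent t k y else None.
Proof.
rewrite /iter_parent iterSr /=; case: (_.[? x]) => //=.
by elim: k => //= k ->.
Qed.

Lemma ancestor_refl t x : ancestor t x x.
Proof. by apply/ancestorP; exists 0. Qed.

Lemma ancestor_parent t x y z :
  (parent t).[? z] = Some y -> ancestor t x y -> ancestor t x z.
Proof.
move=> zy /ancestorP[k yx]; apply/ancestorP; exists k.+1.
by rewrite iter_parentS zy.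
Qed.

Lemma single_is_tree x : is_tree (single x).
Proof.
split=> /=.
- by rewrite inE.
- by apply/fsetP => y; rewrite !inE; case: eqP.
- by move=> y z; rewrite fnd_fmap0.
- by move=> y; rewrite inE => /eqP ->; exact: ancestor_refl.
Qed.

Lemma merge_is_tree t s :
  is_tree t -> is_tree s -> [disjoint nodes t & nodes s]%fset ->
  is_tree (merge t s).
Proof.
move=> tt ts dis.
have Nts x : x \in nodes t -> x \notin nodes s by apply/fdisjointP.
have [rt rs] := (root_in_nodes tt, root_in_nodes ts).
have Nrs : root t != root s.
  by apply: contraTneq rs => <-; exact: Nts.
have parE x : (parent (merge t s)).[? x] =
    if x == root s then Some (root t)
    else if x \in domf (parent s) then (parent s).[? x] else (parent t).[? x].
  by rewrite /= fnd_set fnd_cat.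
have rootA : ancestor (merge t s) (root t) (root s).
  apply: (@ancestor_parent _ _ (root t)); last exact: ancestor_refl.
  by rewrite parE eqxx.
split.
- by rewrite /= inE rt.
- apply: etrans (dom_setf _ _ _) _.
  rewrite domf_cat (parent_dom tt) (parent_dom ts).
  apply/fsetP => x; rewrite !inE.
  case: (eqVneq x (root s)) => [->|xs] /=.
    by rewrite eq_sym Nrs rs orbT.
  case: (eqVneq x (root t)) => [->|_] //=.
  by rewrite (negPf (Nts _ rt)).
- move=> x y; rewrite parE /= inE.
  case: ifP => [_ [<-]|_]; first by rewrite rt.
  by case: ifP => _ /parent_in_nodes -> //; rewrite orbT.
- move=> x; rewrite /= inE => /orP[] xV.
  + have /ancestorP[k] := root_reached tt xV.
    elim: k x xV => [|k IH] x xV; first by case=> ->; exact: ancestor_refl.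
    rewrite iter_parentS; case xy: (_.[? x]) => [y|] //.
    move/(IH _ (parent_in_nodes tt xy)); apply: ancestor_parent.
    have /negPf xd : x \notin domf (parent s).
      by rewrite (parent_dom ts) !inE (negPf (Nts _ xV)) andbF.
    rewrite parE xd xy; case: eqP => // E.
    by move: (Nts _ xV); rewrite E rs.
  + have /ancestorP[k] := root_reached ts xV.
    elim: k x xV => [|k IH] x xV; first by case=> ->.
    rewrite iter_parentS; case xy: (_.[? x]) => [y|] //.
    have xd : x \in domf (parent s) by rewrite -fndSome xy.
    move/(IH _ (parent_in_nodes ts xy)); apply: ancestor_parent.
    rewrite parE xd xy.
    by move: xd; rewrite (parent_dom ts) !inE => /andP[/negPf->].
Qed.

Lemma collapse_is_tree t x : is_tree t -> is_tree (collapse t x).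
Proof.
move=> tt.
have parE z : (parent (collapse t x)).[? z] =
    omap (fun p => if ancestor t z x then root t else p) (parent t).[? z].
  case: (boolP (z \in domf (parent t))) => zd.
    by rewrite (in_fnd zd) (@in_fnd _ _ (parent (collapse t x)) z zd) ffunE.
  by rewrite (not_fnd zd) (@not_fnd _ _ (parent (collapse t x)) z zd).
split.
- exact: root_in_nodes tt.
- exact: parent_dom tt.
- move=> z y; rewrite parE; case zp: (_.[? z]) => [p|] //= [<-].
  case: ifP => _; first exact: root_in_nodes tt.
  exact: parent_in_nodes tt _ _ zp.
- move=> z /= /(root_reached tt) /ancestorP[k].
  elim: k z => [|k IH] z; first by case=> ->; exact: ancestor_refl.
  rewrite iter_parentS; case zp: (_.[? z]) => [p|] // /IH pA.
  case za: (ancestor t z x).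
    apply: (@ancestor_parent _ _ (root t)); last exact: ancestor_refl.
    by rewrite parE zp /= za.
  by apply: ancestor_parent pA; rewrite parE zp /= za.
Qed.

Lemma push_step_is_tree t t' : is_tree t -> push_step t t' -> is_tree t'.
Proof.
move=> tt [x [y [xy [p [xp yp]] ->]]].
have dP z q : (parent t).[? z] = Some q -> z \in nodes t `\ root t.
  by move=> zq; rewrite -(parent_dom tt) -fndSome zq.
split.
- exact: root_in_nodes tt.
- apply: etrans (dom_setf _ _ _) _; rewrite (parent_dom tt); apply/fsetP => z; rewrite in_fset1U.
  by case: eqP => // ->; rewrite (dP _ _ xp).
- move=> z q; rewrite /= fnd_set; case: ifP => _; last first.
    exact: parent_in_nodes tt _ _.
  by move=> [<-]; move: (dP _ _ yp); rewrite inE => /andP[].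
- move=> z /(root_reached tt) /ancestorP[k].
  elim: k z => [|k IH] z; first by case=> ->; exact: ancestor_refl.
  rewrite iter_parentS; case zq: (_.[? z]) => [q|] // /IH qA.
  have yA r : (parent t).[? y] = Some r -> ancestor (push t x y) (root t) r ->
      ancestor (push t x y) (root t) y.
    move=> yr; apply: ancestor_parent.
    by rewrite /= fnd_set; case: eqP => // /esym.
  case: (eqVneq z x) => [zx|zx].
    move: zq; rewrite zx xp => -[pq].
    apply: (@ancestor_parent _ _ y); first by rewrite /= fnd_set eqxx.
    by apply: yA qA; rewrite yp pq.
  by apply: ancestor_parent qA; rewrite /= fnd_set (negPf zx).
Qed.

Lemma union_find_tree_is_tree t : union_find_tree t -> is_tree t.
Proof.
elim=> [x|{}t s _ tt _ ts dis _|{}t x _ tt _].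
- exact: single_is_tree.
- exact: merge_is_tree.
- exact: collapse_is_tree.
Qed.

Lemma union_tree_is_tree t : union_tree t -> is_tree t.
Proof.
elim=> [x|{}t s _ tt _ ts dis _]; first exact: single_is_tree.
exact: merge_is_tree.
Qed.

End Trees.

(* Main.v *)
(* If p is the root, pulling x from its parent y up to its grandparent p is the
   collapse of t at x. If p is not the root, then the edges x -> y -> p have not
   been touched since p was a root, so the same pull can be inserted in the
   construction of t just before p was merged into another tree. Hence
   Union-Find trees are closed under inverse pushes. Conversely, pushing the
   former ancestors of x back under one another undoes a collapse, and pushes
   commute with merges. *)
From Pilot Require Import Defs.
From mathcomp Require Import all_boot finmap.
(* Imported last so that [merge] is not [path.merge]. *)
Import Pilot.Defs.

Set Implicit Arguments.
Unset Strict Implicit.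
Unset Printing Implicit Defensive.

Local Open Scope fset_scope.
Local Open Scope fmap_scope.

(** * Lookups, ancestors and sizes *)

Lemma tree_eq (K : choiceType) (t s : tree K) :
  nodes t = nodes s -> root t = root s ->
  (forall x, (parent t).[? x] = (parent s).[? x]) -> t = s.
Proof. by case: t s => [V r f] [W q g] /= -> -> /fmapP ->. Qed.

Lemma fnd_merge (K : choiceType) (t s : tree K) x :
  (parent (merge t s)).[? x] =
    if x == root s then Some (root t)
    else if x \in domf (parent s) then (parent s).[? x] else (parent t).[? x].
Proof. by rewrite /= fnd_set fnd_cat. Qed.

Lemma fnd_collapse (K : choiceType) (t : tree K) x z :
  (parent (collapse t x)).[? z] =
    omap (fun p => if ancestor t z x then root t else p) (parent t).[? z].
Proof.
case: (boolP (z \in domf (parent t))) => zd.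
  by rewrite (in_fnd zd) (@in_fnd _ _ (parent (collapse t x)) z zd) ffunE.
by rewrite (not_fnd zd) (@not_fnd _ _ (parent (collapse t x)) z zd).
Qed.

Lemma fnd_push (K : choiceType) (t : tree K) x y z :
  (parent (push t x y)).[? z] = if z == x then Some y else (parent t).[? z].
Proof. by rewrite /= fnd_set. Qed.

Lemma in_parent_dom (K : choiceType) (t : tree K) x :
  is_tree t -> (x \in domf (parent t)) = (x != root t) && (x \in nodes t).
Proof. by move=> tt; rewrite (parent_dom tt) !inE. Qed.

Lemma parent_domE (K : choiceType) (t : tree K) x y :
  is_tree t -> (parent t).[? x] = Some y -> (x != root t) && (x \in nodes t).
Proof.
by move=> tt xy; rewrite -in_parent_dom // -fndSome xy.
Qed.

Lemma parent_root (K : choiceType) (t : tree K) :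
  is_tree t -> (parent t).[? root t] = None.
Proof. by move=> tt; apply: not_fnd; rewrite in_parent_dom // eqxx. Qed.

Lemma ancestorE (K : choiceType) (t : tree K) z x :
  ancestor t z x =
    (z == x) || (if (parent t).[? x] is Some y then ancestor t z y else false).
Proof.
apply/idP/idP => [/ancestorP[[|k]]|].
- by case=> ->; rewrite eqxx.
- rewrite iter_parentS; case: (_.[? x]) => // y ky.
  by apply/orP; right; apply/ancestorP; exists k.
- case/orP => [/eqP->|]; first exact: ancestor_refl.
  by case xy: (_.[? x]) => [y|] //; apply: ancestor_parent.
Qed.

(** Acyclicity: if [k.+1] steps led from [x] to itself and [d] steps to the root, then [d + k.+1]
    steps would end at the root when the cycle is taken first, and at [None] when it is taken
    last. *)
Lemma parentNancestor (K : choiceType) (t : tree K) x y :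
  is_tree t -> (parent t).[? x] = Some y -> ~~ ancestor t x y.
Proof.
move=> tt xy; apply/negP => /ancestorP[k yx].
have xx : iter_parent t k.+1 x = Some x by rewrite iter_parentS xy.
have /andP[_ /(root_reached tt)/ancestorP[d xr]] := parent_domE tt xy.
have iterD m n z : iter_parent t (m + n) z =
    obind (iter_parent t m) (iter_parent t n z).
  rewrite {1}/iter_parent iterD -/(iter_parent t n z).
  by case: (iter_parent t n z) => //=; elim: m => //= m ->.
have := xr; rewrite -[LHS]/(obind (iter_parent t d) (Some x)) -xx -iterD.
rewrite addnC iterD xr -[LHS]/(iter_parent t k.+1 (root t)).
by rewrite iter_parentS parent_root.
Qed.

(** Pushes keep the node set, so this carries the size condition of a merge over to pushed trees. *)
Lemma tree_size_nodes (K : choiceType) (t : tree K) :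
  is_tree t -> tree_size t = #|` nodes t|.
Proof.
move=> tt; congr #|` _|; apply/fsetP => x; rewrite !inE /=.
by case: (boolP (x \in nodes t)) => // /(root_reached tt).
Qed.

(** * Closure under inverse pushes *)

Lemma merge_pushl (K : choiceType) (t s : tree K) x y :
  is_tree s -> [disjoint nodes t & nodes s] -> x \in nodes t ->
  merge (push t x y) s = push (merge t s) x y.
Proof.
move=> ts /fdisjointP dis /dis xs; apply: tree_eq => // z.
rewrite fnd_push !fnd_merge fnd_push.
case: (eqVneq z x) => // -> /=.
case: (eqVneq x (root s)) => [E|_]; first by rewrite E root_in_nodes in xs.
by rewrite in_parent_dom // (negPf xs) andbF.
Qed.

(** A non-root node of [s] keeps its own entry in the merge, so the new edge above [root s] does not
    interfere. *)
Lemma merge_pushr (K : choiceType) (t s : tree K) x y :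
  is_tree s -> x \in domf (parent s) ->
  merge t (push s x y) = push (merge t s) x y.
Proof.
move=> ts xd; apply: tree_eq => // z.
rewrite fnd_push !fnd_merge fnd_push /=.
have -> : (z \in domf (parent s).[x <- y]) = (z \in domf (parent s)).
  by rewrite dom_setf in_fset1U; case: eqP => // ->.
case: (eqVneq z x) => // -> /=; rewrite xd.
by move: xd; rewrite in_parent_dom // => /andP[/negPf->].
Qed.

(** The upward path from [z] avoids [x], so it never reads the altered entry. *)
Lemma ancestor_push (K : choiceType) (t : tree K) x p w z :
  ~~ ancestor t x z -> ancestor (push t x p) w z = ancestor t w z.
Proof.
move=> xz.
have E k : iter_parent (push t x p) k z = iter_parent t k z.
  elim: k z xz => // k IH z xz; rewrite !iter_parentS fnd_push.
  case: (eqVneq z x) => [zx|_]; first by rewrite zx ancestor_refl in xz.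
  case zq: (_.[? z]) => [q|] //; apply: IH.
  exact: contra (ancestor_parent zq) xz.
by apply/ancestorP/ancestorP => -[k kw]; exists k; rewrite -kw E.
Qed.

(** At depth two a collapse moves [x] alone, since [y] is already a child of the root. Here [push]
    merely overwrites one parent: [x] and the root are not siblings. *)
Lemma push_root_collapse (K : choiceType) (t : tree K) x y :
  is_tree t -> (parent t).[? x] = Some y -> (parent t).[? y] = Some (root t) ->
  push t x (root t) = collapse t x.
Proof.
move=> tt xy yr; apply: tree_eq => // z.
rewrite fnd_push fnd_collapse ancestorE xy ancestorE yr ancestorE parent_root //.
case: (eqVneq z x) => [->|_] /=; first by rewrite xy.
case: (eqVneq z y) => [->|_] /=; first by rewrite yr.
by case: (eqVneq z (root t)) => [->|_] /=; [rewrite parent_root|case: fnd].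
Qed.

(** Moving [x] up to its grandparent [p] is the inverse of a push. The induction is on the
    construction of [t], and [to_root] settles every case where [p] is the current root. *)
Lemma union_find_pull (K : choiceType) (t : tree K) :
  union_find_tree t ->
  forall x y p, (parent t).[? x] = Some y -> (parent t).[? y] = Some p ->
  union_find_tree (push t x p).
Proof.
have to_root (s : tree K) x y : union_find_tree s -> (parent s).[? x] = Some y ->
    (parent s).[? y] = Some (root s) -> union_find_tree (push s x (root s)).
  move=> us xy yr; have ts := union_find_tree_is_tree us.
  rewrite (push_root_collapse ts xy yr); apply: union_find_collapse => //.
  by have /andP[] := parent_domE ts xy.
elim=> [r|{}t s ut IHt us IHs dis le_st|{}t z ut IHt zt] x y p.
- by rewrite fnd_fmap0.
- have [tt ts] := (union_find_tree_is_tree ut, union_find_tree_is_tree us).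
  move=> xy yp; have um := union_find_merge ut us dis le_st.
  have tm := union_find_tree_is_tree um.
  have Nts w : w \in nodes t ->
      (w == root s = false) * (w \in domf (parent s) = false).
    move/fdisjointP: dis => dis /dis ws; split; last first.
      by rewrite in_parent_dom // (negPf ws) andbF.
    by apply: contraNF ws => /eqP->; exact: root_in_nodes.
  (* [x = root s] is impossible: [y] would be the root of the merged tree, which has no parent. *)
  have := xy; rewrite fnd_merge; case: (eqVneq x (root s)) => [_ [yE]|_].
    by move: yp; rewrite -yE -[root t]/(root (merge t s)) parent_root.
  case: ifP => [xd xy'|_ xy'].
    have ys := parent_in_nodes ts xy'.
    (* If [y = root s], then [p] is the root of the merged tree; otherwise both edges lie in [s]. *)
    have := yp; rewrite fnd_merge; case: (eqVneq y (root s)) => [yE [pE]|yNr].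
      by move: yp; rewrite -pE; exact: to_root.
    rewrite in_parent_dom // yNr ys /= => yp'.
    have up := IHs _ _ _ xy' yp'.
    rewrite -merge_pushr //; apply: union_find_merge => //.
    by move: le_st; rewrite !tree_size_nodes //; exact: union_find_tree_is_tree.
  have yt := parent_in_nodes tt xy'.
  have := yp; rewrite fnd_merge !Nts // => yp'.
  have up := IHt _ _ _ xy' yp'.
  have /andP[_ xt] := parent_domE tt xy'.
  rewrite -merge_pushl //; apply: union_find_merge => //.
  by move: le_st; rewrite !tree_size_nodes //; exact: union_find_tree_is_tree.
- move=> xy yp; have tt := union_find_tree_is_tree ut.
  have uc := union_find_collapse ut zt.
  have [pr|pNr] := eqVneq p (root t).
    by move: yp; rewrite pr; exact: (to_root _ _ _ uc xy).
  (* A collapse only creates edges into the root. Neither [p] nor [y] is the root, so both edges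
     come from [t], and neither [x] nor [y] is an ancestor of [z]. *)
  move: xy yp; rewrite !fnd_collapse.
  case xE: (parent t).[? x] => [q|] //= [yE].
  case yE': (parent t).[? y] => [r|] //= [].
  case: ifP => [_ rp|_ rp]; first by rewrite rp eqxx in pNr.
  have yNr : y != root t by have /andP[] := parent_domE tt yE'.
  move: yE; case xz: (ancestor t x z) => yE; first by rewrite yE eqxx in yNr.
  have -> : push (collapse t z) x p = collapse (push t x p) z.
    apply: tree_eq => // w; rewrite fnd_push !fnd_collapse fnd_push.
    rewrite ancestor_push ?xz //.
    by case: eqVneq => //= ->; rewrite xz.
  by apply: union_find_collapse => //; apply: IHt xE _; rewrite yE yE' rp.
Qed.

(** The common parent [p] of the siblings becomes the grandparent of [x], so pulling [x] back to [p]
    undoes the push. *)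
Lemma push_step_union_find (K : choiceType) (t t' : tree K) :
  push_step t t' -> union_find_tree t' -> union_find_tree t.
Proof.
move=> [x [y [/eqP xy [p [xp yp]] ->]]] ut.
have -> : t = push (push t x y) x p.
  by apply: tree_eq => // z; rewrite !fnd_push; case: eqVneq => // ->.
apply: (union_find_pull ut (y := y)); first by rewrite fnd_push eqxx.
by rewrite fnd_push eq_sym (negPf xy).
Qed.

(** * Push sequences through merges and collapses *)

Lemma push_steps_nodes (K : choiceType) (t t' : tree K) :
  push_steps t t' -> nodes t = nodes t'.
Proof. by elim=> [{}t _ [x [y [_ _ ->]]]|//|t1 t2 t3 _ -> _ ->]. Qed.

Lemma push_steps_is_tree (K : choiceType) (t t' : tree K) :
  push_steps t t' -> is_tree t -> is_tree t'.
Proof.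
elim=> [t1 t2 st tt|//|t1 t2 t3 _ IH1 _ IH2 /IH1 //].
exact: push_step_is_tree tt st.
Qed.

Lemma push_steps_mergel (K : choiceType) (t t' s : tree K) :
  push_steps t t' -> is_tree t -> is_tree s ->
  [disjoint nodes t & nodes s] -> push_steps (merge t s) (merge t' s).
Proof.
move=> st tt ts; elim: st tt => [t1 t2|*|t1 t2 t3 st IH1 _ IH2 tt dis].
- move=> [x [y [xy [p [xp yp]] ->]]] tt dis.
  have /andP[_ xV] := parent_domE tt xp; have /andP[_ yV] := parent_domE tt yp.
  apply: rt_step; exists x, y; split=> //; last exact: merge_pushl.
  have Nts w : w \in nodes t1 -> (parent (merge t1 s)).[? w] = (parent t1).[? w].
    move/fdisjointP: dis => dis /dis ws; rewrite fnd_merge.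
    rewrite in_parent_dom // (negPf ws) andbF.
    by case: eqP => // E; rewrite E root_in_nodes in ws.
  by exists p; rewrite !Nts.
- exact: rt_refl.
- apply: (rt_trans _ _ _ (merge t2 s)); first exact: IH1.
  by apply: IH2; [exact: push_steps_is_tree st tt|rewrite -(push_steps_nodes st)].
Qed.

Lemma push_steps_merger (K : choiceType) (t s s' : tree K) :
  push_steps s s' -> is_tree s -> push_steps (merge t s) (merge t s').
Proof.
elim=> [s1 s2|*|s1 s2 s3 st IH1 _ IH2 ts].
- move=> [x [y [xy [p [xp yp]] ->]]] ts.
  have dom w q : (parent s1).[? w] = Some q -> w \in domf (parent s1).
    by move=> wq; rewrite -fndSome wq.
  apply: rt_step; exists x, y; split=> //; last exact: merge_pushr (dom _ _ xp).
  exists p; rewrite !fnd_merge (dom _ _ xp) (dom _ _ yp) xp yp.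
  have /andP[/negPf-> _] := parent_domE ts xp.
  by have /andP[/negPf-> _] := parent_domE ts yp.
- exact: rt_refl.
- apply: (rt_trans _ _ _ (merge t s2)); first exact: IH1.
  exact/IH2/push_steps_is_tree/ts.
Qed.

(** Induction on the depth [k] of [x]. After the collapse at [x], both [x] and its parent [y] are
    children of the root, and pushing [x] under [y] gives the collapse at [y]. *)
Lemma push_steps_collapse (K : choiceType) (t : tree K) x :
  is_tree t -> x \in nodes t -> push_steps (collapse t x) t.
Proof.
move=> tt /(root_reached tt)/ancestorP[k].
elim: k x => [|k IH] x.
  case=> ->; rewrite [X in push_steps X](_ : _ = t); first exact: rt_refl.
  apply: tree_eq => // z; rewrite fnd_collapse ancestorE parent_root // orbF.
  by case: eqVneq => [->|_]; [rewrite parent_root|case: fnd].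
rewrite iter_parentS; case xy: (_.[? x]) => [y|] // yr.
(* Without a grandparent, [x] is a child of the root and the collapse changes nothing. *)
case yp: ((parent t).[? y]) => [p|]; last first.
  have {yp yr} yr : y = root t.
    by case: k yr {IH} => [[]|k] //; rewrite iter_parentS yp.
  rewrite [X in push_steps X](_ : _ = t); first exact: rt_refl.
  apply: tree_eq => // z.
  rewrite fnd_collapse ancestorE xy ancestorE yr parent_root // orbF.
  case: eqVneq => [->|_] /=; first by rewrite xy yr.
  by case: eqVneq => [->|_]; [rewrite parent_root|case: fnd].
apply: rt_trans (IH _ yr); apply: rt_step; exists x, y.
have xNy := parentNancestor tt xy.
split; first by move=> E; rewrite E ancestor_refl in xNy.
  exists (root t); rewrite !fnd_collapse xy yp /= ancestor_refl.
  by rewrite (ancestor_parent xy) ?ancestor_refl.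
(* By acyclicity [x] is not an ancestor of [y], so [collapse t y] keeps the edge from [x] to [y]. *)
apply: tree_eq => // z; rewrite fnd_push !fnd_collapse [ancestor t z x]ancestorE xy.
by case: eqVneq => [->|//] /=; rewrite xy /= (negPf xNy).
Qed.

Theorem theorem2 (K : choiceType) (t : tree K) (ht : is_tree t) :
  union_find_tree t <-> exists s : tree K, union_tree s /\ push_steps t s.
Proof.
split=> [|[s [us ts]]].
  move=> {ht}; elim=> [x||{}t x ut [s [us ts]] xt].
  - by exists (single x); split; [exact: union_single|exact: rt_refl].
  - move=> t1 t2 ut1 [s1 [us1 st1]] ut2 [s2 [us2 st2]] dis le21.
    have [tt1 tt2] := (union_find_tree_is_tree ut1, union_find_tree_is_tree ut2).
    have [ts1 ts2] := (union_tree_is_tree us1, union_tree_is_tree us2).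
    exists (merge s1 s2); split.
      (* Disjointness and the size condition pass to [s1] and [s2], which have the same nodes as
         [t1] and [t2]. *)
      move: dis le21; rewrite !tree_size_nodes //.
      rewrite (push_steps_nodes st1) (push_steps_nodes st2) => dis le21.
      by apply: union_merge; rewrite // !tree_size_nodes.
    apply: (rt_trans _ _ _ (merge s1 t2)); first exact: push_steps_mergel.
    exact: push_steps_merger.
  - exists s; split=> //; apply: rt_trans ts.
    exact: push_steps_collapse (union_find_tree_is_tree ut) xt.
(* Union trees are Union-Find trees; the pushes are then undone from [s] back to [t]. *)
have {us} : union_find_tree s.
  by elim: us => *; [exact: union_find_single|exact: union_find_merge].
elim: ts => [t1 t2 st|//|t1 t2 t3 _ IH1 _ IH2 /IH2/IH1 //].
exact: push_step_union_find.
Qed.
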